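(* Let a complex tensor network with at least two leaves be given and fix a binary contraction tree $T$ for it. Classify each pairwise contraction step of $T$ as a merge (both operands green), a ride (exactly one operand green) or a pass (no operand green). Let $m$ and $r$ be the fractions of the total volume of $T$, measured on the real skeleton, that are carried by merge steps and by ride steps respectively. Then the realified contraction on the same tree $T$ has arithmetic overhead (its total number of real scalar multiplications divided by the total volume of $T$ on the real skeleton) satisfying $$\text{overhead} = 1 + 2m + r, \qquad 1 \le \text{overhead} \le 3,$$ and every intermediate tensor of the realified contraction has an element count at most $2$ times the element count of its real-skeleton counterpart (the intermediate at the same node of $T$ in the real skeleton).
   Context: Tensor networks and trees. A tensor network is a finite collection of tensors (leaves) whose axes are labelled by indices; each index has a dimension $\ge 1$, and some indices are designated open. Every non-open index appears on at least two tensors. A binary contraction tree is a full binary tree whose leaves are the tensors of the network; each internal node is a pairwise contraction step. The intermediate at a node whose subtree contains the leaf set $S$ carries exactly those indices that appear on some leaf in $S$ and are either open or also appear on a leaf outside $S$; it is obtained from its two children by multiplying and summing over the indices that are no longer carried. The real skeleton is the same network with the same indices and tree, with all tensors treated as real. The volume of a step is its scalar-multiplication count on the real skeleton: the product of the dimensions of all indices occurring on at least one of the two operands. The total volume of $T$ is the sum of the volumes of all its steps. Green tensors. A leaf is green if it is a genuinely complex tensor (nonzero imaginary part); otherwise it is real. An intermediate is green if and only if its subtree contains at least one green leaf. Realification. A green tensor $A = A_R + iA_I$ ($A_R,A_I$ real) is replaced by the real tensor $T_A$ obtained by stacking $A_R$ and $A_I$ along one additional index of dimension $2$ (the green leg);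 real tensors are left unchanged. Let $Z=\mathrm{diag}(1,-1)$ and let $\mathcal{C}\in\mathbb{R}^{2\times2\times2}$ be the structure tensor $\mathcal{C}_{abc}=\operatorname{Re}(i^{a+b+c-3})$, $a,b,c\in\{1,2\}$, so that $M_{abc}=\sum_{c'}\mathcal{C}_{abc'}Z_{c'c}$ is the multiplication tensor of $\mathbb{C}$ over $\mathbb{R}$, i.e. $(xy)_c=\sum_{a,b}M_{abc}x_ay_b$ with component $1$ the real part and component $2$ the imaginary part. The realified contraction on the tree $T$. At a pass step the two real operands are contracted as on the skeleton. At a ride step the green leg of the single green operand is carried along as an additional spectator index of dimension $2$ to the output. At a merge step the two green legs are contracted with $\mathcal{C}$ followed by $Z$ on its third leg, which becomes the green leg of the output; this is executed through the decomposition $\mathcal{C}=\sum_{k=1}^{3}u_k\otimes v_k\otimes w_k$ with $(u_1,v_1,w_1)=(e_1,e_1,e_1+e_2)$, $(u_2,v_2,w_2)=(e_2,e_2,-e_1+e_2)$, $(u_3,v_3,w_3)=(e_1+e_2,e_1+e_2,-e_2)$, where $e_1,e_2$ is the standard basis of $\mathbb{R}^2$: for each $k$ one contracts the green leg of the first operand with $u_k$ and that of the second with $v_k$, contracts the two resulting real tensors with each other as on the skeleton, and combines the three results with coefficients $w_k$ and $Z$. Cost is counted in real scalar multiplications between operand entries in these real tensor contractions; additions, and multiplications by the constant entries $0,\pm1$ of $u_k,v_k,w_k,Z$, are not counted. *)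

(* Defs.v *)
From HB Require Import structures.
From mathcomp Require Import all_boot all_order all_algebra.
From mathcomp Require Import complex.
From mathcomp Require Import reals.

Set Implicit Arguments.
Unset Strict Implicit.
Unset Printing Implicit Defensive.

Import Order.TTheory GRing.Theory Num.Theory.
Local Open Scope ring_scope.

(* Tensors over an index type J, the index j having dimension dim j. The axes
   of a tensor are labelled by a set of indices, so distinct axes of one tensor
   carry distinct indices. *)

Definition position (J : finType) (dim : J -> nat) (A : {set J}) : finType :=
  {dffun forall j : {j | j \in A}, 'I_(dim (val j))}.

Definition restrict (J : finType) (dim : J -> nat) (A B : {set J})
    (sAB : A \subset B) (x : position dim B) : position dim A :=
  finfun (fun j : {j | j \in A} =>
    x (exist _ (val j) (subsetP sAB (val j) (valP j))) : 'I_(dim (val j))).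

Record tensor (J : finType) (dim : J -> nat) (K : Type) := Tensor {
  legs : {set J};
  entry : position dim legs -> K }.

Arguments Tensor {J} dim {K} legs entry.

Definition nelements (J : finType) (dim : J -> nat) (A : {set J}) : nat :=
  #|position dim A|.

(* Multiply a and b and sum over the indices that are not in keep. The sum has
   one product of an entry of a by an entry of b for each position on the union
   of the two sets of legs; these products are what nb_mults counts. *)
Definition contract (J : finType) (dim : J -> nat) (K : pzRingType)
    (keep : {set J}) (a b : tensor dim K) : tensor dim K :=
  Tensor dim ((legs a :|: legs b) :&: keep) (fun z =>
    \sum_(x : position dim (legs a :|: legs b) |
            restrict (subsetIl (legs a :|: legs b) keep) x == z)
       entry (restrict (subsetUl (legs a) (legs b)) x)
       * entry (restrict (subsetUr (legs a) (legs b)) x)).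

Definition nb_mults (J : finType) (dim : J -> nat) (K : Type)
    (a b : tensor dim K) : nat :=
  #|position dim (legs a :|: legs b)|.

Record network (R : realType) (I V : finType) := Network {
  index_dim : I -> nat;
  index_dim_gt0 : forall i, (0 < index_dim i)%N;
  leaf_tensor : V -> tensor index_dim R[i];
  open_index : {set I};
  closed_index_shared : forall i, i \notin open_index ->
    (1 < #|[set v | i \in legs (leaf_tensor v)]|)%N }.

Inductive tree (V : Type) :=
  | Leaf of V
  | Node of tree V & tree V.

Fixpoint leaves (V : Type) (t : tree V) : seq V :=
  match t with
  | Leaf v => [:: v]
  | Node l r => leaves l ++ leaves r
  end.

Definition contraction_tree (V : finType) (t : tree V) : bool :=
  perm_eq (leaves t) (enum V).

Definition leafset (V : finType) (t : tree V) : {set V} := [set v in leaves t].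

Fixpoint subtree (V : Type) (s t : tree V) : Prop :=
  s = t \/ match t with
           | Leaf _ => False
           | Node l r => subtree s l \/ subtree s r
           end.

(* A contraction step is given by its two operands. *)
Fixpoint steps (V : Type) (t : tree V) : seq (tree V * tree V) :=
  match t with
  | Leaf _ => [::]
  | Node l r => (l, r) :: steps l ++ steps r
  end.

Definition kept (R : realType) (I V : finType) (N : network R I V)
    (S : {set V}) : {set I} :=
  [set i | (i \in open_index N)
           || [exists v, (v \notin S) && (i \in legs (leaf_tensor N v))]].

Definition carried (R : realType) (I V : finType) (N : network R I V)
    (S : {set V}) : {set I} :=
  [set i | [exists v, (v \in S) && (i \in legs (leaf_tensor N v))]
           && (i \in kept N S)].

Definition volume (R : realType) (I V : finType) (N : network R I V)
    (s : tree V * tree V) : nat :=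
  (\prod_(i in carried N (leafset s.1) :|: carried N (leafset s.2))
      index_dim N i)%N.

Definition total_volume (R : realType) (I V : finType) (N : network R I V)
    (T : tree V) : nat :=
  (\sum_(s <- steps T) volume N s)%N.

Definition green_leaf (R : realType) (I V : finType) (N : network R I V)
    (v : V) : bool :=
  [exists x, complex.Im (entry (t := leaf_tensor N v) x) != 0].

Definition green (R : realType) (I V : finType) (N : network R I V)
    (t : tree V) : bool :=
  has (green_leaf N) (leaves t).

Definition is_merge (R : realType) (I V : finType) (N : network R I V)
    (s : tree V * tree V) : bool := green N s.1 && green N s.2.

Definition is_ride (R : realType) (I V : finType) (N : network R I V)
    (s : tree V * tree V) : bool := green N s.1 (+) green N s.2.

Definition merge_fraction (R : realType) (I V : finType) (N : network R I V)
    (T : tree V) : rat :=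
  (\sum_(s <- steps T | is_merge N s) volume N s)%N%:R
    / (total_volume N T)%:R.

Definition ride_fraction (R : realType) (I V : finType) (N : network R I V)
    (T : tree V) : rat :=
  (\sum_(s <- steps T | is_ride N s) volume N s)%N%:R
    / (total_volume N T)%:R.

(* In the realified network the index Some i is the index i of the original
   network and None is the green leg. *)
Definition rdim (I : Type) (dim : I -> nat) (j : option I) : nat :=
  if j is Some i then dim i else 2.

Definition forget_green (I : finType) (dim : I -> nat) (A : {set I})
    (x : position (rdim dim) (Some @: A)) : position dim A :=
  finfun (fun i : {i | i \in A} =>
    x (exist _ (Some (val i)) (imset_f Some (valP i))) : 'I_(dim (val i))).

Definition real_leaf (R : realType) (I : finType) (dim : I -> nat)
    (a : tensor dim R[i]) : tensor (rdim dim) R :=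
  Tensor (rdim dim) (Some @: legs a) (fun x =>
    complex.Re (entry (forget_green x))).

Definition stacked_leaf (R : realType) (I : finType) (dim : I -> nat)
    (a : tensor dim R[i]) : tensor (rdim dim) R :=
  Tensor (rdim dim) (None |: Some @: legs a) (fun x =>
    let z := entry (forget_green (restrict (subsetUr [set None] _) x)) in
    if (x (exist _ None (setU11 None _)) : 'I_2) == 0
    then complex.Re z else complex.Im z).

(* A row vector as a tensor whose only leg is the green leg. *)
Definition green_vector (R : realType) (I : finType) (dim : I -> nat)
    (u : 'rV[R]_2) : tensor (rdim dim) R :=
  Tensor (rdim dim) [set None] (fun x =>
    u 0 (x (exist _ None (set11 None)) : 'I_2)).

Definition e1 (R : realType) : 'rV[R]_2 := delta_mx 0 0.
Definition e2 (R : realType) : 'rV[R]_2 := delta_mx 0 1.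

Definition uvec (R : realType) (k : 'I_3) : 'rV[R]_2 :=
  nth 0 [:: e1 R; e2 R; e1 R + e2 R] k.
Definition vvec (R : realType) (k : 'I_3) : 'rV[R]_2 :=
  nth 0 [:: e1 R; e2 R; e1 R + e2 R] k.
Definition wvec (R : realType) (k : 'I_3) : 'rV[R]_2 :=
  nth 0 [:: e1 R + e2 R; - e1 R + e2 R; - e2 R] k.

Definition Zmx (R : realType) : 'M[R]_2 := diag_mx (e1 R - e2 R).

(* With 0-based indices the exponent a + b + c - 3 becomes a + b + c. *)
Definition Ctensor (R : realType) (a b c : 'I_2) : R :=
  complex.Re ('i%C ^+ (a + b + c) : R[i]).

Lemma Ctensor_decomposition (R : realType) (a b c : 'I_2) :
  Ctensor R a b c =
  \sum_(k < 3) uvec R k 0 a * vvec R k 0 b * wvec R k 0 c.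
Proof.
rewrite !big_ord_recl big_ord0 /Ctensor /uvec /vvec /wvec /e1 /e2 /= !mxE.
case: a => [[|[|//]] ?]; case: b => [[|[|//]] ?]; case: c => [[|[|//]] ?] /=;
rewrite ?mxE /= ?(expr0, expr1, exprS) /=;
by rewrite ?(mul0r, mulr0, mul1r, mulr1, add0r, addr0, oppr0, subr0, sub0r,
  mulrN, mulNr, opprK, subrr, addNr).
Qed.

(* The green leg of a contracted with u. *)
Definition slice (R : realType) (I : finType) (dim : I -> nat)
    (a : tensor (rdim dim) R) (u : 'rV[R]_2) : tensor (rdim dim) R :=
  contract (~: [set None]) a (green_vector dim u).

(* The terms have the same legs, since the legs of a slice do not depend on the
   vector. *)
Definition merge_contract (R : realType) (I : finType) (dim : I -> nat)
    (keep : {set option I}) (a b : tensor (rdim dim) R) :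
    tensor (rdim dim) R :=
  let term k :=
    contract [set: option I]
      (contract keep (slice a (uvec R k)) (slice b (vvec R k)))
      (green_vector dim (wvec R k *m Zmx R)) in
  Tensor (rdim dim) (legs (term 0)) (fun x =>
    \sum_(k < 3) entry (t := term k) x).

Definition merge_mults (R : realType) (I : finType) (dim : I -> nat)
    (a b : tensor (rdim dim) R) : nat :=
  (\sum_(k < 3) nb_mults (slice a (uvec R k)) (slice b (vvec R k)))%N.

(* The tensor at the root of t in the realified contraction. In a ride step
   None is an index of exactly one operand and is kept, so that the green leg is
   a spectator; in a pass step None does not occur. *)
Fixpoint realified (R : realType) (I V : finType) (N : network R I V)
    (t : tree V) : tensor (rdim (index_dim N)) R :=
  match t with
  | Leaf v =>
      if green_leaf N v then stacked_leaf (leaf_tensor N v)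
      else real_leaf (leaf_tensor N v)
  | Node l r =>
      let keep := None |: Some @: kept N (leafset t) in
      if is_merge N (l, r) then merge_contract keep (realified N l) (realified N r)
      else contract keep (realified N l) (realified N r)
  end.

Definition realified_step_mults (R : realType) (I V : finType)
    (N : network R I V) (s : tree V * tree V) : nat :=
  if is_merge N s then merge_mults (realified N s.1) (realified N s.2)
  else nb_mults (realified N s.1) (realified N s.2).

Definition overhead (R : realType) (I V : finType) (N : network R I V)
    (T : tree V) : rat :=
  (\sum_(s <- steps T) realified_step_mults N s)%N%:R
    / (total_volume N T)%:R.

(* Main.v *)
(* A realified tensor carries the legs of its skeleton counterpart, plus the
   green leg of dimension 2 exactly when it is green. Hence a pass step costs
   its volume, a ride step twice its volume, and a merge step, being three
   contractions of tensors whose green legs are contracted away, three times its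
   volume. *)
Require Import Defs.
From HB Require Import structures.
From mathcomp Require Import all_boot all_order all_algebra.
From mathcomp Require Import complex.
From mathcomp Require Import reals.
From mathcomp Require Import ring lra zify.
Set Implicit Arguments.
Unset Strict Implicit.

Import Order.TTheory GRing.Theory Num.Theory.
Local Open Scope ring_scope.

Lemma nelementsE (J : finType) (dim : J -> nat) (A : {set J}) :
  nelements dim A = (\prod_(j in A) dim j)%N.
Proof.
rewrite /nelements card_dep_ffun foldrE big_map big_enum /=.
rewrite [RHS](big_sub (mem A)) /=.
by apply: eq_bigr => j _; rewrite card_ord.
Qed.

(** A boolean records the presence of the green leg [None], so that pass, ride and merge steps are
    handled by one formula: unions of legs become disjunctions of booleans. *)
Definition green_legs (I : finType) (b : bool) (A : {set I}) : {set option I} :=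
  if b then None |: Some @: A else Some @: A.

Lemma mem_green_legs_Some (I : finType) (b : bool) (A : {set I}) i :
  (Some i \in green_legs b A) = (i \in A).
Proof.
by case: b; rewrite /green_legs ?inE ?mem_imset //; apply: Some_inj.
Qed.

Lemma mem_green_legs_None (I : finType) (b : bool) (A : {set I}) :
  (None \in green_legs b A) = b.
Proof.
case: b; rewrite /green_legs ?inE ?eqxx //.
by apply/negbTE/imsetP => -[].
Qed.

Definition mem_green_legs := (mem_green_legs_Some, mem_green_legs_None).

Lemma green_legsU (I : finType) (b c : bool) (A B : {set I}) :
  green_legs b A :|: green_legs c B = green_legs (b || c) (A :|: B).
Proof. by apply/setP => -[i|]; rewrite !(mem_green_legs, inE). Qed.

Lemma nelements_green_legs (I : finType) (dim : I -> nat) b (A : {set I}) :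
  nelements (rdim dim) (green_legs b A) = ((1 + b) * nelements dim A)%N.
Proof.
have prodE : (\prod_(j in Some @: A) rdim dim j = \prod_(i in A) dim i)%N.
  by rewrite big_imset //= => i j _ _ [].
rewrite !nelementsE; case: b => /=; last by rewrite mul1n.
rewrite big_setU1 ?prodE //=.
by apply/imsetP => -[].
Qed.

Lemma leafset_node (V : finType) (l r : tree V) :
  leafset (Node l r) = leafset l :|: leafset r.
Proof. by apply/setP => v; rewrite !inE mem_cat. Qed.

Lemma kept_subset (R : realType) (I V : finType) (N : network R I V)
    (S S' : {set V}) : S \subset S' -> kept N S' \subset kept N S.
Proof.
move=> /subsetP sSS'; apply/subsetP => i; rewrite !inE.
case/orP => [->//|/existsP[v /andP[vS' iv]]].
apply/orP; right; apply/existsP; exists v; apply/andP; split=> //.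
exact: contra (sSS' v) vS'.
Qed.

Lemma mem_carried (R : realType) (I V : finType) (N : network R I V)
    (S : {set V}) i :
  (i \in carried N S)
    = [exists v in S, i \in legs (leaf_tensor N v)] && (i \in kept N S).
Proof. by rewrite in_set. Qed.

(** Since [kept] is antitone, an index kept for the union is kept for both parts; for such an index,
    being carried only means occurring on some leaf. This puts the carried indices at a node in the
    form of the legs that [contract] produces. *)
Lemma carriedU (R : realType) (I V : finType) (N : network R I V)
    (S S' : {set V}) :
  carried N (S :|: S') = (carried N S :|: carried N S') :&: kept N (S :|: S').
Proof.
apply/setP => i; rewrite !in_setI in_setU !mem_carried.
have [iK|] := boolP (i \in kept N (S :|: S')); rewrite ?andbF // !andbT.
have -> : i \in kept N S by apply: subsetP iK; apply/kept_subset/subsetUl.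
have -> : i \in kept N S' by apply: subsetP iK; apply/kept_subset/subsetUr.
rewrite !andbT; apply/existsP/orP => [[v /andP[]]|].
  by rewrite in_setU => /orP[] vS iv; [left | right]; apply/existsP; exists v;
     rewrite vS.
by case=> /existsP[v /andP[vS iv]]; exists v; rewrite in_setU vS ?orbT.
Qed.

(** A closed index of [v] lies on at least two tensors, hence on a leaf other than [v], so no index
    of a leaf is dropped. *)
Lemma carried_leaf (R : realType) (I V : finType) (N : network R I V) v :
  carried N (leafset (Leaf v)) = legs (leaf_tensor N v).
Proof.
apply/setP => i; rewrite mem_carried.
have -> : [exists w in leafset (Leaf v), i \in legs (leaf_tensor N w)]
          = (i \in legs (leaf_tensor N v)).
  apply/existsP/idP => [[w]|iv]; last by exists v; rewrite !inE eqxx.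
  by rewrite !inE => /andP[/eqP->].
case: (boolP (i \in legs _)) => //= iv; rewrite in_set.
have [//|/closed_index_shared] := boolP (i \in open_index N).
rewrite (cardsD1 v) in_set iv ltnS card_gt0 => /set0Pn[w].
by rewrite !inE => /andP[wv iw]; apply/existsP; exists w; rewrite !inE wv.
Qed.

Lemma legs_slice (R : realType) (I : finType) (dim : I -> nat)
    (a : tensor (rdim dim) R) (u : 'rV[R]_2) b A :
  legs a = green_legs b A -> legs (slice a u) = green_legs false A.
Proof.
move=> aA; rewrite [LHS]/= aA.
by apply/setP => -[i|]; rewrite !(mem_green_legs, inE) ?andbT ?orbF ?andbF.
Qed.

(** Slicing removes the green legs of both operands; the factor built from [wvec] and [Zmx] then
    supplies the green leg of the output. *)
Lemma legs_merge_contract (R : realType) (I : finType) (dim : I -> nat)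
    (K : {set I}) (a b : tensor (rdim dim) R) c d A B :
  legs a = green_legs c A -> legs b = green_legs d B ->
  legs (merge_contract (None |: Some @: K) a b)
    = green_legs true ((A :|: B) :&: K).
Proof.
move=> aA bB; rewrite [LHS]/= aA bB -[None |: _]/(green_legs true K).
by apply/setP => -[i|]; rewrite !(mem_green_legs, inE) ?andbT ?orbF ?orbT.
Qed.

(** The invariant behind both the cost and the size bounds, by induction on the tree. Outside merges
    [None] is kept, so the green leg survives exactly when an operand has it. *)
Lemma legs_realified (R : realType) (I V : finType) (N : network R I V) t :
  legs (realified N t) = green_legs (green N t) (carried N (leafset t)).
Proof.
elim: t => [v|l IHl r IHr].
  by rewrite carried_leaf /green /= orbF; case: (green_leaf N v).
have greenE : green N (Node l r) = green N l || green N r by rewrite /green has_cat.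
rewrite greenE leafset_node carriedU -leafset_node /=.
case: ifPn => [mrg|_].
  rewrite (legs_merge_contract _ IHl IHr).
  by move: mrg; rewrite /is_merge /= => /andP[-> _].
rewrite /= IHl IHr -[None |: _]/(green_legs true _) green_legsU.
by apply/setP => -[i|]; rewrite !(mem_green_legs, inE) ?andbT.
Qed.

(** The overhead formula for a single step, with indicators as coefficients so that it can be summed
    over all steps. *)
Lemma realified_step_multsE (R : realType) (I V : finType)
    (N : network R I V) s :
  realified_step_mults N s
    = (volume N s + 2 * (is_merge N s * volume N s) + is_ride N s * volume N s)%N.
Proof.
have nbE b A c B (x y : tensor (rdim (index_dim N)) R) :
    legs x = green_legs b A -> legs y = green_legs c B ->
    nb_mults x y = ((1 + (b || c)) * nelements (index_dim N) (A :|: B))%N.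
  move=> xA yB; rewrite -[LHS]/(nelements _ (legs x :|: legs y)).
  by rewrite xA yB green_legsU nelements_green_legs.
rewrite /realified_step_mults /volume -nelementsE.
have [l r] := (legs_realified N s.1, legs_realified N s.2).
case: ifPn => [mrg|mrgN].
  rewrite /merge_mults.
  (* Slices have no green leg, so each of the three terms costs exactly the skeleton volume. *)
  under eq_bigr do rewrite (nbE _ _ _ _ _ _ (legs_slice _ l) (legs_slice _ r)).
  rewrite big_const_ord /=.
  by move: mrg; rewrite /is_merge /is_ride => /andP[-> ->] /=; lia.
rewrite (nbE _ _ _ _ _ _ l r); move: mrgN; rewrite /is_merge /is_ride.
by case: (green N s.1) (green N s.2) => -[] //= _; lia.
Qed.

Lemma total_volume_gt0 (R : realType) (I V : finType) (N : network R I V) l r :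
  (0 < total_volume N (Node l r))%N.
Proof.
rewrite /total_volume big_cons ltn_addr // /volume prodn_cond_gt0 // => i _.
exact: index_dim_gt0.
Qed.

Theorem theorem4 (R : realType) (I V : finType) (N : network R I V)
    (T : tree V) (two_leaves : (1 < #|V|)%N) (HT : contraction_tree T) :
  [/\ overhead N T = 1 + 2 * merge_fraction N T + ride_fraction N T,
      1 <= overhead N T <= 3
    & forall t : tree V, subtree t T ->
        (nelements (rdim (index_dim N)) (legs (realified N t))
         <= 2 * nelements (index_dim N) (carried N (leafset t)))%N].
Proof.
have W_gt0 : (0 < total_volume N T)%N.
  (* A tree that is a single leaf would force [V] to have one element. *)
  case: T HT => [v /perm_size|l r _]; last exact: total_volume_gt0.
  by rewrite -cardE /= => V1; rewrite -V1 in two_leaves.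
pose M := (\sum_(s <- steps T | is_merge N s) volume N s)%N.
pose D := (\sum_(s <- steps T | is_ride N s) volume N s)%N.
have condE (P : pred (tree V * tree V)) :
    (\sum_(s <- steps T | P s) volume N s
     = \sum_(s <- steps T) P s * volume N s)%N.
  by rewrite big_mkcond; apply: eq_bigr => s _; case: (P s); rewrite ?mul1n.
have multsE : (\sum_(s <- steps T) realified_step_mults N s
               = total_volume N T + 2 * M + D)%N.
  rewrite /M /D !condE big_distrr -!big_split /=.
  by apply: eq_bigr => s _; rewrite realified_step_multsE.
(* No step is both a merge and a ride. With m + r at most 1, the upper bound follows from 1 + 2m + r
   <= 1 + 2(m + r) <= 3. *)
have MD_le : (M + D <= total_volume N T)%N.
  rewrite /M /D !condE -big_split /=.
  apply: leq_sum => s _; rewrite /is_merge /is_ride.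
  by case: (green N s.1) (green N s.2) => -[] /=; rewrite ?mul1n ?addn0.
have W_gt0' : 0 < (total_volume N T)%:R :> rat by rewrite ltr0n.
have overheadE :
    overhead N T = 1 + 2 * merge_fraction N T + ride_fraction N T.
  rewrite /overhead /merge_fraction /ride_fraction multsE -/M -/D 2!natrD natrM.
  by field; rewrite gt_eqF.
have m_ge0 : 0 <= merge_fraction N T by rewrite divr_ge0 ?ler0n.
have r_ge0 : 0 <= ride_fraction N T by rewrite divr_ge0 ?ler0n.
have mr_le1 : merge_fraction N T + ride_fraction N T <= 1.
  by rewrite -mulrDl ler_pdivrMr // mul1r -natrD ler_nat.
split=> // [|t _]; first by rewrite overheadE; lra.
by rewrite legs_realified nelements_green_legs leq_mul2r; case: green; rewrite orbT.
Qed.
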